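(* Let $p\ge 2$ be an integer, $f(u)=\frac1p u^p$, and consider $u_t+f(u)_x+(1-\partial_x^2)^{-1}u_x=0$ on $I=[a,b]$ with periodic boundary conditions. Let $u_h,v_h,q_h$ (time-dependent, with values in $V_h^k$) be a solution of the semi-discrete local discontinuous Galerkin (LDG) scheme described in the context. Then: (i) for Scheme $\mathcal{D}1$, $$\frac{d}{dt}E_0(u_h)=\frac{d}{dt}\int_I u_h\,dx=0,\qquad \frac{d}{dt}E_2(u_h)=\frac{d}{dt}\int_I u_h^2\,dx\le 0;$$ (ii) for Scheme $\mathcal{C}1$, $$\frac{d}{dt}E_0(u_h)=\frac{d}{dt}\int_I u_h\,dx=0,\qquad \frac{d}{dt}E_2(u_h)=\frac{d}{dt}\int_I u_h^2\,dx=0.$$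
   Context: Mesh and space: $a=x_{1/2}<x_{3/2}<\dots<x_{N+1/2}=b$, $I_j=[x_{j-1/2},x_{j+1/2}]$, $V_h^k=\{v: v|_{I_j}\in P^k(I_j),\ 1\le j\le N\}$, where $P^k(I_j)$ is the set of polynomials of degree at most $k$ on $I_j$ (functions may be discontinuous across cell interfaces). $u^-_{j+1/2}$, $u^+_{j+1/2}$ are the traces at $x_{j+1/2}$ from $I_j$ and $I_{j+1}$ respectively (with periodic identification at the endpoints). Jump: $[u]=u^+-u^-$; average: $\{u\}=\frac12(u^++u^-)$. Also $(u,v)_{I_j}=\int_{I_j}uv\,dx$ and $\langle\hat u,v\rangle_{I_j}=\hat u_{j+1/2}v^-_{j+1/2}-\hat u_{j-1/2}v^+_{j-1/2}$. LDG scheme: find $u_h,v_h,q_h\in V_h^k$ such that for all $j$ and all test functions $\phi,\varphi,\psi\in V_h^k$, $$((u_h)_t,\phi)_{I_j}+\langle\widehat{f(u_h)},\phi\rangle_{I_j}-(f(u_h),\phi_x)_{I_j}+(v_h,\phi)_{I_j}=0,$$ $$(v_h,\varphi)_{I_j}-\langle\widehat{q_h},\varphi\rangle_{I_j}+(q_h,\varphi_x)_{I_j}=\langle\widehat{u_h},\varphi\rangle_{I_j}-(u_h,\varphi_x)_{I_j},$$ $$(q_h,\psi)_{I_j}=\langle\widehat{v_h},\psi\rangle_{I_j}-(v_h,\psi_x)_{I_j}.$$ Scheme $\mathcal{D}1$ uses the Godunov flux $\widehat{f(u_h)}=\min_{u_h^-\le w\le u_h^+}f(w)$ if $u_h^-<u_h^+$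 and $\widehat{f(u_h)}=\max_{u_h^+\le w\le u_h^-}f(w)$ if $u_h^+\le u_h^-$, together with $\widehat{q_h}=q_h^-$, $\widehat{v_h}=v_h^+$, $\widehat{u_h}=u_h^-$. Scheme $\mathcal{C}1$ uses $\widehat{f(u_h)}=[F(u_h)]/[u_h]$ if $[u_h]\ne0$ and $\widehat{f(u_h)}=f(\{u_h\})$ if $[u_h]=0$, where $F(u)=\int^u f(\tau)\,d\tau$ (equivalently $\widehat{f(u_h)}=\frac{1}{p(p+1)}\sum_{m=0}^p (u_h^+)^{p-m}(u_h^-)^m$), together with $\widehat{q_h}=\{q_h\}$, $\widehat{v_h}=\{v_h\}$, $\widehat{u_h}=\{u_h\}$. $E_0(u)=\int_I u\,dx$ is the mass and $E_2(u)=\int_I u^2\,dx$ the energy. *)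

(* Defs.v *)
From HB Require Import structures.
From mathcomp Require Import all_boot all_order all_algebra.
From mathcomp Require Import all_classical all_reals all_analysis.

Set Implicit Arguments.
Unset Strict Implicit.
Unset Printing Implicit Defensive.

Import Order.TTheory GRing.Theory Num.Theory.
Import numFieldNormedType.Exports.

Local Open Scope classical_set_scope.
Local Open Scope ring_scope.

(* Cells are numbered j = 0, ..., N-1, and cell j is [x j, x j.+1]; the values
   of x beyond N are irrelevant. *)
Definition is_mesh (R : realType) (a b : R) (N : nat) (x : nat -> R) : Prop :=
  [/\ (0 < N)%N, x 0%N = a, x N = b & forall j, (j < N)%N -> x j < x j.+1].

Definition cell (R : realType) (x : nat -> R) (j : nat) : set R :=
  `[x j, x j.+1].

(* A discontinuous piecewise polynomial is given by one polynomial per cell, so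
   that it has two values at each interface. *)
Notation broken R N := ('I_N -> {poly R}).

Definition Vh (R : realType) (N k : nat) (v : broken R N) : Prop :=
  forall j, (size (v j) <= k.+1)%N.

(* Interfaces are numbered by the cell on their left: interface i lies between
   cell i and its cyclic successor ordS i. Hence interface i is the right end
   of cell i, and interface ord_pred j is the left end of cell j; the last
   interface identifies b with a. *)
Definition tr_minus (R : realType) (N : nat) (x : nat -> R) (v : broken R N)
  (i : 'I_N) : R := (v i).[x i.+1].

Definition tr_plus (R : realType) (N : nat) (x : nat -> R) (v : broken R N)
  (i : 'I_N) : R := (v (ordS i)).[x (ordS i)].

(* A numerical flux is a function of the two traces, in the order (u^-, u^+). *)
Definition hat (R : realType) (N : nat) (x : nat -> R) (g : R -> R -> R)
  (v : broken R N) (i : 'I_N) : R := g (tr_minus x v i) (tr_plus x v i).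

Definition ip (R : realType) (x : nat -> R) (j : nat) (g h : R -> R) : R :=
  \int[@lebesgue_measure R]_(y in cell x j) (g y * h y).

Definition bd (R : realType) (N : nat) (x : nat -> R) (h : 'I_N -> R)
  (phi : broken R N) (j : 'I_N) : R :=
  h j * tr_minus x phi j - h (ord_pred j) * tr_plus x phi (ord_pred j).

Definition dt (R : realType) (N : nat) (u : R -> broken R N) (t : R) (j : 'I_N)
  (y : R) : R := derive1 (fun s : R => (u s j).[y]) t.

Definition LDG_solution (R : realType) (N k : nat) (x : nat -> R)
    (f : R -> R) (fhat uhat vhat qhat : R -> R -> R) (J : set R)
    (u v q : R -> broken R N) : Prop :=
  (forall t, J t -> [/\ Vh k (u t), Vh k (v t) & Vh k (q t)]) /\
  (forall t, J t -> forall (j : 'I_N) (y : R), cell x j y ->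
     derivable (fun s : R => (u s j).[y]) t 1) /\
  (forall t, J t -> forall phi : broken R N, Vh k phi -> forall j : 'I_N,
     [/\ ip x j (dt u t j) (horner (phi j))
           + bd x (hat x fhat (u t)) phi j
           - ip x j (fun y => f (u t j).[y]) (horner (deriv (phi j)))
           + ip x j (horner (v t j)) (horner (phi j)) = 0,
         ip x j (horner (v t j)) (horner (phi j))
           - bd x (hat x qhat (q t)) phi j
           + ip x j (horner (q t j)) (horner (deriv (phi j)))
         = bd x (hat x uhat (u t)) phi j
           - ip x j (horner (u t j)) (horner (deriv (phi j)))
       & ip x j (horner (q t j)) (horner (phi j))
         = bd x (hat x vhat (v t)) phi j
           - ip x j (horner (v t j)) (horner (deriv (phi j)))]).

Definition flux_minus (R : realType) (um up : R) : R := um.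
Definition flux_plus (R : realType) (um up : R) : R := up.
Definition flux_avg (R : realType) (um up : R) : R := (um + up) / 2.

(* For continuous f the infimum and supremum below are attained. *)
Definition godunov (R : realType) (f : R -> R) (um up : R) : R :=
  if um < up then inf [set f w | w in `[um, up]]
  else sup [set f w | w in `[up, um]].

Definition flux_cons (R : realType) (f F : R -> R) (um up : R) : R :=
  if up - um != 0 then (F up - F um) / (up - um) else f (flux_avg um up).

Definition D1_solution (R : realType) (N k : nat) (x : nat -> R) (f : R -> R)
    (J : set R) (u v q : R -> broken R N) : Prop :=
  LDG_solution k x f (godunov f)
    (@flux_minus R) (@flux_plus R) (@flux_minus R) J u v q.

(* The flux depends on F only through its increments, so any antiderivative F
   of f gives the same scheme. *)
Definition C1_solution (R : realType) (N k : nat) (x : nat -> R) (f F : R -> R)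
    (J : set R) (u v q : R -> broken R N) : Prop :=
  LDG_solution k x f (flux_cons f F)
    (@flux_avg R) (@flux_avg R) (@flux_avg R) J u v q.

(* Right-continuous representative on [a, b[; its values at the nodes do not
   affect integrals. *)
Definition glue (R : realType) (N : nat) (x : nat -> R) (v : broken R N)
  (y : R) : R := \sum_(j < N) (v j).[y] * \1_(`[x j, x j.+1[) y.

Definition E0 (R : realType) (a b : R) (N : nat) (x : nat -> R)
  (v : broken R N) : R :=
  \int[@lebesgue_measure R]_(y in `[a, b]) glue x v y.

Definition E2 (R : realType) (a b : R) (N : nat) (x : nat -> R)
  (v : broken R N) : R :=
  \int[@lebesgue_measure R]_(y in `[a, b]) (glue x v y ^+ 2).

Definition power_flux (R : realType) (p : nat) (w : R) : R := w ^+ p / p%:R.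

(* Main.v *)
From HB Require Import structures.
Require Import Defs.
From mathcomp Require Import all_boot all_order all_algebra.
From mathcomp Require Import all_classical all_reals all_analysis.
From mathcomp Require Import qpoly ring lra.
Set Implicit Arguments.
Unset Strict Implicit.
Unset Printing Implicit Defensive.

Import Order.TTheory GRing.Theory Num.Theory.
Import numFieldNormedType.Exports.
Local Open Scope classical_set_scope.
Local Open Scope ring_scope.

(** At a fixed time, take a flux g and a primitive F of a continuous f.  The
    form sum_j (<g, phi>_j - (f(w), phi_x)_j) on the diagonal phi = w is a sum
    over interfaces, because f(w) w_x is the exact derivative of F(w): it is
    the sum of the productions [F(w)] - g [w] ([sum_dg_diag]).  Apply this to
    the three equations tested with phi = u, varphi = q + u and psi = v.  The
    second one is the choice that makes the linear part telescope: since
    q and u carry the same additive flux, it says that (v, q) + (v, u) is the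
    diagonal form of q + u, and by the third one (v, q) is that of v.
    Adding up ([energy_balance]),

      E2' = -2 sum ( P_fhat(u) + P_qhat(q + u) - P_vhat(v) ),

    where the linear fluxes are measured with the entropy y^2/2.  With the
    one-sided fluxes of the dissipative scheme P_qhat is [q + u]^2/2 and P_vhat
    is -[v]^2/2, and the Godunov production is
    nonnegative because [F] = f(xi) [u] for some xi between the traces and
    the flux is extremal there.  With averages and with [F]/[u] every
    production vanishes.  Mass is conserved for all fluxes
    ([mass_balance]): for phi = 1 only flux differences remain, and they
    telescope around the period.

    It remains to differentiate E0 and E2 under the integral.  On each cell u
    is a polynomial of bounded degree that is differentiable in time at every
    point of the cell, so by interpolation at finitely many points of the
    cell its coefficients are differentiable ([curve_derive_interp]), and
    integrals of u and u^2 are fixed polynomial functions of them. *)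

(** * Integrals of polynomials over a cell *)

Section CellIntegral.
Context {R : realType}.
Implicit Types (c d : R) (g : {poly R}).
Local Notation mu := (@lebesgue_measure R).

Definition integral_poly (c d : R) (g : {poly R}) : R :=
  \int[mu]_(y in `[c, d]) g.[y].

Lemma integrable_horner c d g : mu.-integrable `[c, d] (EFin \o horner g).
Proof.
apply: continuous_compact_integrable; first exact: segment_compact.
by apply: continuous_subspaceT => y; exact: continuous_horner.
Qed.

Lemma integral_poly_is_linear c d : linear (integral_poly c d : {poly R} -> R^o).
Proof.
move=> r g h; rewrite /integral_poly.
under eq_Rintegral => y _ do rewrite hornerD hornerZ.
have intrg : mu.-integrable `[c, d] (EFin \o (fun y => r * g.[y])).
  have := integrable_horner c d (r *: g).
  by congr (mu.-integrable _ _); apply/funext => y /=; rewrite hornerZ.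
rewrite RintegralD//; last exact: integrable_horner.
by rewrite RintegralZl//; exact: integrable_horner.
Qed.

HB.instance Definition _ c d :=
  GRing.isLinear.Build R {poly R} R^o _
    (integral_poly c d) (integral_poly_is_linear c d).

(** The integrand is (F o g)'; this is the integration by parts of the scheme,
    for the convective term as well as, with f = id, for the linear ones. *)
Lemma Rintegral_comp_deriv (f F : R -> R) c d g : c < d -> continuous f ->
  (forall w : R, is_derive w 1 F (f w)) ->
  \int[mu]_(y in `[c, d]) (f g.[y] * (g^`()).[y]) = F g.[d] - F g.[c].
Proof.
move=> cd cf dF.
have dFg (y : R) : is_derive y 1 (F \o horner g) (f g.[y] * (g^`()).[y]).
  by apply: is_derive1_comp; exact: dF.
have cFg : continuous (F \o horner g).
  move=> y; apply/differentiable_continuous/derivable1_diffP.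
  by have [] := dFg y.
rewrite /Rintegral (@continuous_FTC2 _ _ (F \o horner g))//.
- apply: continuous_subspaceT => y.
  apply: cvgM; last exact: continuous_horner.
  by apply: (@continuous_comp _ _ _ (horner g) f y);
    [exact: continuous_horner|exact: cf].
- split.
  + by move=> y _; have [] := dFg y.
  + exact/cvg_at_right_filter/cFg.
  + exact/cvg_at_left_filter/cFg.
- by move=> y _; rewrite derive1E derive_val.
Qed.

Lemma ip_horner (x : nat -> R) j g h :
  ip x j (horner g) (horner h) = integral_poly (x j) (x j.+1) (g * h).
Proof. by apply: eq_Rintegral => y _; rewrite hornerM. Qed.

End CellIntegral.

(** * Mass and energy as sums over the cells *)

Section Gluing.
Context {R : realType} {a b : R} {N : nat} {x : nat -> R}.
Hypothesis hx : is_mesh a b N x.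
Implicit Types v : 'I_N -> {poly R}.
Local Notation mu := (@lebesgue_measure R).

Lemma mesh_le (i j : nat) : (i <= j)%N -> (j <= N)%N -> x i <= x j.
Proof.
case: hx => _ _ _ xlt; elim: j => [|j IH]; first by rewrite leqn0 => /eqP->.
rewrite leq_eqVlt => /predU1P[->//|]; rewrite ltnS => ij jN.
by rewrite (le_trans (IH ij (ltnW jN)))// ltW// xlt.
Qed.

Lemma mesh_lt (j : 'I_N) : x j < x j.+1.
Proof. by case: hx => _ _ _; apply. Qed.

(** The pieces of the glued function live on half-open cells, which differ
    from the closed ones by null sets. *)
Lemma E0_sum v : E0 a b x v = \sum_(j < N) integral_poly (x j) (x j.+1) (v j).
Proof.
have sub (j : 'I_N) : `[x j, x j.+1[ `<=` `[a, b].
  case: hx => _ <- <- _ y /=; rewrite !in_itv/= => /andP[xy yx].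
  rewrite (le_trans (@mesh_le 0 j _ (ltnW (ltn_ord j))) xy)//=.
  by rewrite (le_trans (ltW yx))// mesh_le.
have intI (j : 'I_N) :
    mu.-integrable `[x j, x j.+1[ (EFin \o horner (v j)).
  apply: integrableS (integrable_horner (x j) (x j.+1) (v j)) => //.
  by apply: subset_itvl; rewrite bnd_simp.
have intP (j : 'I_N) :
    mu.-integrable `[a, b] (EFin \o (horner (v j) \_ `[x j, x j.+1[)).
  rewrite -restrict_EFin; apply/integrable_restrict => //=.
  by rewrite setIidr//; exact: sub.
have -> : E0 a b x v =
    \int[mu]_(y in `[a, b]) (\sum_(j < N) (horner (v j) \_ `[x j, x j.+1[) y).
  apply: eq_Rintegral => y _; apply: eq_bigr => j _.
  by rewrite patch_indic.
rewrite /Rintegral; under eq_integral do rewrite -sumEFin.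
rewrite integral_sum// -sum_fine; last first.
  by move=> j _; apply: integrable_fin_num => //; exact: intP.
apply: eq_bigr => j _.
transitivity (\int[mu]_(y in `[a, b]) (horner (v j) \_ `[x j, x j.+1[) y) => //.
rewrite -Rintegral_mkcondr setIidr; last exact: sub.
by rewrite Rintegral_itv_bndo_bndc.
Qed.

(** Half-open cells are disjoint, so the square has no cross terms, and the
    energy of v is the mass of the squares of its pieces. *)
Lemma glue_sqr v y : Defs.glue x v y ^+ 2 = Defs.glue x (fun j => v j ^+ 2) y.
Proof.
rewrite /Defs.glue.
have [[j yj]|noj] := pselect (exists j : 'I_N, y \in `[x j, x j.+1[).
  have off (i : 'I_N) : i != j -> \1_(`[x i, x i.+1[) y = 0 :> R.
    move=> ij; rewrite indicE memNset// => yi; move: yj yi.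
    rewrite /= !in_itv/= => /andP[xjy yxj] /andP[xiy yxi].
    case: (ltngtP i j) => [lt_ij|lt_ji|/val_inj eij].
    - by have := @mesh_le i.+1 j lt_ij (ltnW (ltn_ord j)); lra.
    - by have := @mesh_le j.+1 i lt_ji (ltnW (ltn_ord i)); lra.
    - by rewrite eij eqxx in ij.
  rewrite (bigD1 j)//= [X in _ + X]big1; last by move=> i /off ->; rewrite mulr0.
  rewrite [RHS](bigD1 j)//= [X in _ = _ + X]big1; last first.
    by move=> i /off ->; rewrite mulr0.
  by rewrite !addr0 indicE mem_set// !mulr1 horner_exp.
have off (i : 'I_N) : \1_(`[x i, x i.+1[) y = 0 :> R.
  by rewrite indicE memNset// => yi; apply: noj; exists i.
by rewrite !big1 ?expr0n// => i _; rewrite off mulr0.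
Qed.

Lemma E2_sum v :
  E2 a b x v = \sum_(j < N) integral_poly (x j) (x j.+1) (v j ^+ 2).
Proof. by rewrite -E0_sum; apply: eq_Rintegral => y _; rewrite glue_sqr. Qed.

End Gluing.

(** * Time derivatives of curves of polynomials *)

Section PolynomialCurve.
Context {R : realType}.
Implicit Types (w : R -> {poly R}) (t : R).

Lemma is_derive_fun_sum n (h : 'I_n -> R -> R) (dh : 'I_n -> R) t :
  (forall i, is_derive t 1 (h i) (dh i)) ->
  is_derive t 1 (fun s => \sum_(i < n) h i s) (\sum_(i < n) dh i).
Proof.
move=> hdh; have := @is_derive_sum _ _ _ _ h t 1 dh hdh.
by congr is_derive; apply/funext => s; rewrite fct_sumE.
Qed.

Lemma is_derive_mulr_cst (f : R -> R) (df r t : R) :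
  is_derive t 1 f df -> is_derive t 1 (fun s => f s * r) (df * r).
Proof.
move=> dfx; have := @is_deriveZ _ _ _ f r t 1 df dfx.
by rewrite mulrC; congr is_derive; apply/funext => s /=; rewrite mulrC.
Qed.

(** Testing with linear functionals avoids choosing a topology on polynomials;
    in bounded degree, where such functionals separate points and are all
    continuous, this is the usual derivative.  Evaluation at a point and
    integration over a cell are the functionals of interest. *)
Definition curve_derive w t (wd : {poly R}) :=
  forall l : {linear {poly R} -> R^o},
    is_derive t 1 (fun s => l (w s) : R) (l wd).

(** Lagrange interpolation at n + 1 points of the cell writes w s as a
    combination of fixed polynomials whose coefficients are point values of
    w s, hence differentiable; this transfers differentiability from points of
    the cell to every linear functional. *)
Lemma curve_derive_interp w t (c d : R) n : c < d ->
  (\forall s \near t, (size (w s) <= n.+1)%N) ->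
  (forall y, y \in `[c, d] -> derivable (fun s => (w s).[y]) t 1) ->
  exists wd, curve_derive w t wd.
Proof.
move=> cd wsize wder; pose X (i : nat) := c + (d - c) / i.+1%:R.
have dc0 : d - c != 0 by rewrite subr_eq0 gt_eqF.
have Xinj : injective X.
  move=> i j /addrI/(mulfI dc0)/invr_inj/eqP.
  by rewrite eqr_nat => /eqP[].
have Xcd i : X i \in `[c, d].
  rewrite in_itv/= /X lerDl divr_ge0 ?subr_ge0 ?(ltW cd)//=.
  rewrite -lerBrDl ler_pdivrMr// ler_peMr ?subr_ge0 ?ler1n//.
  exact: ltW.
pose L (i : 'I_n.+1) : {poly R} := tnth (lagrange n.+1 X) i.
exists (\sum_(i < n.+1) 'D_1 (fun s => (w s).[X i]) t *: L i) => l.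
have key : is_derive t 1 (fun s => \sum_(i < n.+1) (w s).[X i] * l (L i))
    (\sum_(i < n.+1) 'D_1 (fun s => (w s).[X i]) t * l (L i)).
  apply: is_derive_fun_sum => i; apply: is_derive_mulr_cst.
  exact/derivableP/wder.
have -> : l (\sum_(i < n.+1) 'D_1 (fun s => (w s).[X i]) t *: L i) =
    \sum_(i < n.+1) 'D_1 (fun s => (w s).[X i]) t * l (L i).
  by rewrite linear_sum; apply: eq_bigr => i _; rewrite linearZ.
apply: near_eq_is_derive key; near=> s.
rewrite [in RHS](@lagrange_gen _ n.+1 X _ Xinj (w s))//; last by near: s.
rewrite linear_sum; apply: eq_bigr => i _.
by rewrite mul_polyC linearZ.
Unshelve. all: by end_near. Qed.

(** Product rule.  Expanding one factor in monomials gives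
    l (w s * q) = sum_i (w s)_i l ('X^i * q), which at q = w s is a finite sum
    of products of two differentiable functions of s: a coefficient of w s and
    a linear functional of w s. *)
Lemma curve_derive_sqr w t wd n :
  (\forall s \near t, (size (w s) <= n)%N) -> curve_derive w t wd ->
  curve_derive (fun s => w s ^+ 2) t ((wd * w t) *+ 2).
Proof.
move=> wsize dw l.
have wE : \forall s \near t, w s = \sum_(i < n) (w s)`_i *: 'X^i.
  near=> s; rewrite -poly_def; apply/polyP => i; rewrite coef_poly.
  case: ltnP => // ni; rewrite nth_default// (leq_trans _ ni)//.
  by near: s.
have wEt := nbhs_singleton wE.
pose lX (i : nat) : {linear {poly R} -> R^o} := l \o ('X^i \*o idfun).
have wdE s q : w s = \sum_(i < n) (w s)`_i *: 'X^i ->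
    l (w s * q) = \sum_(i < n) (w s)`_i * lX i q.
  move=> {1}->; rewrite mulr_suml linear_sum; apply: eq_bigr => i _.
  by rewrite -scalerAl linearZ.
have dcoef (i : nat) : is_derive t 1 (fun s => (w s)`_i) wd`_i.
  exact: (dw (coefp i)).
have key : is_derive t 1 (fun s => \sum_(i < n) (w s)`_i * lX i (w s))
    (\sum_(i < n) ((w t)`_i * lX i wd + lX i (w t) * wd`_i)).
  apply: is_derive_fun_sum => i.
  exact: (is_deriveM (dcoef i) (dw (lX i))).
(* Coefficients of degree at least n vanish near t, so their derivatives do. *)
have wdsize : (size wd <= n)%N.
  apply/leq_sizeP => i ni; have [_ <-] := dcoef i.
  have -> : 'D_1 (fun s => (w s)`_i) t = 'D_1 (cst (0 : R)) t.
    apply: near_eq_derive; near=> s; rewrite nth_default// (leq_trans _ ni)//.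
    by near: s.
  by rewrite derive_cst.
have -> : l (wd * w t *+ 2) =
    \sum_(i < n) ((w t)`_i * lX i wd + lX i (w t) * wd`_i).
  rewrite big_split/= -wdE// mulr2n linearD; congr +%R; first by rewrite mulrC.
  rewrite {1}(_ : wd = \sum_(i < n) wd`_i *: 'X^i).
    rewrite mulr_suml linear_sum; apply: eq_bigr => i _.
    by rewrite -scalerAl linearZ [RHS]mulrC.
  rewrite -poly_def; apply/polyP => i; rewrite coef_poly.
  by case: ltnP => // ni; rewrite nth_default// (leq_trans _ ni).
apply: near_eq_is_derive key; near=> s.
by rewrite expr2 wdE//; near: s.
Unshelve. all: by end_near. Qed.

End PolynomialCurve.

(** * Balance of mass and energy for general fluxes *)

Section EnergyBalance.
Context {R : realType} {a b : R} {N : nat} {x : nat -> R}.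
Hypothesis hx : is_mesh a b N x.
Implicit Types (h : 'I_N -> R) (w phi : 'I_N -> {poly R}).

(** Summation by parts around the period: each interface is the right end of
    one cell and the left end of its cyclic successor. *)
Lemma sum_bd h phi : \sum_(j < N) bd x h phi j =
  \sum_(i < N) h i * (tr_minus x phi i - tr_plus x phi i).
Proof.
under [RHS]eq_bigr => i _ do rewrite mulrBr.
rewrite /bd !sumrB; congr (_ - _).
by rewrite [RHS](reindex_inj (can_inj (@ord_predK N))).
Qed.

Lemma sum_endpoints (G : R -> R) w :
  \sum_(j < N) (G (w j).[x j.+1] - G (w j).[x j]) =
  \sum_(i < N) (G (tr_minus x w i) - G (tr_plus x w i)).
Proof.
rewrite !sumrB; congr (_ - _).
by rewrite (reindex_inj (can_inj (@ordSK N))).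
Qed.

(** When F' = f this is the integral of f(w) - g(u^-, u^+) for w from u^- to
    u^+, the amount of the energy y^2/2 that the flux g removes at an
    interface. *)
Definition entropy_production (F : R -> R) (g : R -> R -> R) (um up : R) : R :=
  F up - F um - g um up * (up - um).

Definition total_production (F : R -> R) (g : R -> R -> R) w : R :=
  \sum_(i < N) entropy_production F g (tr_minus x w i) (tr_plus x w i).

(** The cell integrals of f(w) w_x contribute only end values of F(w), so
    nothing but interface terms survives. *)
Lemma sum_dg_diag (f F : R -> R) (g : R -> R -> R) w :
  continuous f -> (forall y : R, is_derive y 1 F (f y)) ->
  \sum_(j < N) (bd x (hat x g w) w j
                - ip x j (fun y => f (w j).[y]) (horner (w j)^`()))
  = total_production F g w.
Proof.
move=> cf dF; rewrite sumrB sum_bd.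
under [X in _ - X]eq_bigr => j _ do
  rewrite /ip (Rintegral_comp_deriv _ (mesh_lt hx j) cf dF).
rewrite (sum_endpoints F) -sumrB; apply: eq_bigr => i _.
by rewrite /entropy_production /hat; ring.
Qed.

Definition half_sqr (y : R) : R := y ^+ 2 / 2.

Lemma is_derive_half_sqr (y : R) : is_derive y 1 half_sqr y.
Proof.
have -> : half_sqr = horner (2^-1 *: 'X^2).
  by apply/funext => z; rewrite /half_sqr hornerZ hornerXn mulrC.
apply: (is_derive_eq (is_derive_poly _ y)).
by rewrite derivZ derivXn hornerZ hornerMn hornerXn; lra.
Qed.

Section Solution.
Context {k : nat} {f : R -> R} {fhat uhat vhat qhat : R -> R -> R}.
Context {J : set R} {u v q : R -> 'I_N -> {poly R}} {t : R}.
Hypotheses (hJ : open J) (Jt : J t).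
Hypothesis sol : LDG_solution k x f fhat uhat vhat qhat J u v q.

Lemma nearJ : \forall s \near t, J s.
Proof. exact: open_nbhs_nbhs. Qed.

Lemma near_size (j : 'I_N) : \forall s \near t, (size (u s j) <= k.+1)%N.
Proof.
apply: filterS nearJ => s Js.
by have [/(_ s Js)[/(_ j)]] := sol.
Qed.

(** The scheme provides time derivatives only at the points of a cell; the
    openness of J makes the degree bound available around t, as interpolation
    requires. *)
Lemma time_derivative : exists ud : 'I_N -> {poly R},
  forall j, curve_derive (fun s => u s j) t (ud j).
Proof.
suff /boolp.choice[ud udP] : forall j : 'I_N,
    exists wd, curve_derive (fun s => u s j) t wd by exists ud.
move=> j; apply: (@curve_derive_interp _ _ _ _ _ k (mesh_lt hx j)).
  exact: near_size.
by move=> y yj; have [_ [/(_ t Jt j y) + _]] := sol; apply.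
Qed.

Context {ud : 'I_N -> {poly R}}.
Hypothesis hud : forall j, curve_derive (fun s => u s j) t (ud j).

Lemma dt_horner j : dt u t j = horner (ud j).
Proof.
apply/funext => y; rewrite /dt derive1E.
by have [_ eD] := hud j (horner_eval y); exact: eD.
Qed.

Lemma is_derive_E0 : is_derive t 1 (fun s => E0 a b x (u s))
  (\sum_(j < N) integral_poly (x j) (x j.+1) (ud j)).
Proof.
have -> : (fun s => E0 a b x (u s)) =
    fun s => \sum_(j < N) integral_poly (x j) (x j.+1) (u s j).
  by apply/funext => s; rewrite (E0_sum hx).
by apply: is_derive_fun_sum => j; exact: hud.
Qed.

Lemma is_derive_E2 : is_derive t 1 (fun s => E2 a b x (u s))
  (\sum_(j < N) integral_poly (x j) (x j.+1) (ud j * u t j) *+ 2).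
Proof.
have -> : (fun s => E2 a b x (u s)) =
    fun s => \sum_(j < N) integral_poly (x j) (x j.+1) (u s j ^+ 2).
  by apply/funext => s; rewrite (E2_sum hx).
apply: is_derive_fun_sum => j; rewrite -raddfMn.
exact: (curve_derive_sqr (near_size j) (hud j)).
Qed.

End Solution.

(** Testing with phi = 1 kills the derivative terms.  The first equation then
    involves the integral of v, which the second one turns into flux
    differences as well. *)
Lemma mass_balance k f fhat uhat vhat qhat (J : set R)
    (u v q : R -> 'I_N -> {poly R}) (t : R) :
  open J -> J t -> LDG_solution k x f fhat uhat vhat qhat J u v q ->
  is_derive t 1 (fun s => E0 a b x (u s)) 0.
Proof.
move=> hJ Jt sol; have [ud hud] := time_derivative hJ Jt sol.
suff <- : \sum_(j < N) integral_poly (x j) (x j.+1) (ud j) = 0.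
  exact: is_derive_E0.
pose one : 'I_N -> {poly R} := fun=> 1.
have one_Vh : Vh k one by move=> j; rewrite size_poly1.
have ip0 (j : 'I_N) g : ip x j g (horner (one j)^`()) = 0.
  rewrite /one -[1]/(1%:P) derivC /ip.
  under eq_Rintegral do rewrite horner0 mulr0.
  by rewrite /Rintegral integral0.
have bd0 h : \sum_(j < N) bd x h one j = 0.
  rewrite sum_bd big1// => i _.
  by rewrite /tr_minus /tr_plus !hornerC subrr mulr0.
have [_ [_ /(_ t Jt _ one_Vh)eqs]] := sol.
have eq_ud (j : 'I_N) : integral_poly (x j) (x j.+1) (ud j) =
    - (bd x (hat x fhat (u t)) one j + bd x (hat x qhat (q t)) one j
       + bd x (hat x uhat (u t)) one j).
  have [] := eqs j; rewrite !ip0 (dt_horner hud) !ip_horner /= !mulr1.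
  by move=> e1 e2 _; lra.
rewrite (eq_bigr _ (fun j _ => eq_ud j)) sumrN 2!big_split/= !bd0.
by rewrite !addr0 oppr0.
Qed.

(** Additivity is what lets the fluxes of q and u merge into the flux of
    q + u. *)
Definition additive_flux (g : R -> R -> R) : Prop :=
  forall um up wm wp, g (um + wm) (up + wp) = g um up + g wm wp.

(** Testing the second equation with q + u gives (v, q) + (v, u) as the diagonal
    form of q + u; the third one with v gives (q, v) as the diagonal form of v.
    Their difference is the value of (v, u) in the first equation tested with
    u. *)
Lemma energy_balance k (f F : R -> R) fhat g vhat (J : set R)
    (u v q : R -> 'I_N -> {poly R}) (t : R) :
  continuous f -> (forall y : R, is_derive y 1 F (f y)) -> additive_flux g ->
  open J -> J t -> LDG_solution k x f fhat g vhat g J u v q ->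
  is_derive t 1 (fun s => E2 a b x (u s))
    (- (total_production F fhat (u t)
        + total_production half_sqr g (fun j => q t j + u t j)
        - total_production half_sqr vhat (v t)) *+ 2).
Proof.
move=> cf dF gadd hJ Jt sol; have [ud hud] := time_derivative hJ Jt sol.
have hE2 := is_derive_E2 hJ Jt sol hud.
move: hE2; congr is_derive; rewrite sumrMnl; congr (_ *+ 2).
have [/(_ t Jt)[uV vV qV] [_ /(_ t Jt)eqs]] := sol.
pose z j := q t j + u t j.
have zV : Vh k z.
  by move=> j; rewrite (leq_trans (size_polyD _ _))// geq_max qV uV.
have hatz i : hat x g z i = hat x g (q t) i + hat x g (u t) i.
  by rewrite /hat /tr_minus /tr_plus !hornerD gadd.
rewrite -(sum_dg_diag fhat (u t) cf dF).
rewrite -(sum_dg_diag g z (f := id) (fun=> cvg_id) is_derive_half_sqr).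
rewrite -(sum_dg_diag vhat (v t) (f := id) (fun=> cvg_id) is_derive_half_sqr).
rewrite -big_split -sumrB -sumrN; apply: eq_bigr => j _ /=.
have [+ _ _] := eqs _ uV j; have [_ + _] := eqs _ zV j; have [_ _] := eqs _ vV j.
have -> : bd x (hat x g z) z j =
    bd x (hat x g (q t)) z j + bd x (hat x g (u t)) z j.
  by rewrite /bd !hatz; ring.
rewrite (dt_horner hud) !ip_horner.
have -> : v t j * z j = q t j * v t j + v t j * u t j by rewrite mulrDr mulrC.
have -> : z j * (z j)^`() = q t j * (z j)^`() + u t j * (z j)^`().
  by rewrite -mulrDl.
rewrite ![integral_poly _ _ (_ + _)]linearD/=.
lra.
Qed.

End EnergyBalance.

(** * The productions of the fluxes of the two schemes *)

Section Fluxes.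
Context {R : realType}.
Implicit Types (f F : R -> R) (um up : R).

Lemma production_minus um up :
  entropy_production half_sqr (@flux_minus R) um up = (up - um) ^+ 2 / 2.
Proof. by rewrite /entropy_production /half_sqr /flux_minus; field. Qed.

Lemma production_plus um up :
  entropy_production half_sqr (@flux_plus R) um up = - ((up - um) ^+ 2 / 2).
Proof. by rewrite /entropy_production /half_sqr /flux_plus; field. Qed.

Lemma production_avg um up :
  entropy_production half_sqr (@flux_avg R) um up = 0.
Proof. by rewrite /entropy_production /half_sqr /flux_avg; field. Qed.

(** The flux is the difference quotient of F, so its product with the jump is
    the jump of F; equal traces make both sides vanish. *)
Lemma production_cons f F um up :
  entropy_production F (flux_cons f F) um up = 0.
Proof.
rewrite /entropy_production /flux_cons.
case: eqVneq => [/subr0_eq ->|ne] /=; first by rewrite !subrr mulr0 subr0.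
by rewrite divfK ?subrr.
Qed.

(** By the mean value theorem the production is (f(c) - g)(u^+ - u^-) for some
    c between the traces; the minimum or the maximum in the definition of g is
    taken so that both factors have the same sign.  Continuity makes the
    range of f between the traces bounded, so that inf and sup are comparable
    with f(c). *)
Lemma production_godunov f F um up : continuous f ->
  (forall w : R, is_derive w 1 F (f w)) ->
  0 <= entropy_production F (godunov f) um up.
Proof.
move=> cf dF; rewrite /entropy_production /godunov.
have cw A : {within A, continuous f} by exact: continuous_subspaceT.
have cF A : {within A, continuous F}.
  apply: continuous_subspaceT => y; apply/differentiable_continuous.
  by apply/derivable1_diffP; have [] := dF y.
case: ltP => [lt|le].
- have [c cI ->] := MVT_segment (ltW lt) (fun y _ => dF y) (cF _).
  rewrite -mulrBl mulr_ge0 ?subr_ge0 ?(ltW lt)//.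
  apply: ge_inf; last by exists c.
  have [m _ hm] := EVT_min (ltW lt) (cw _).
  by exists (f m) => _ [w wI <-]; exact: hm.
- have [c cI e] := MVT_segment le (fun y _ => dF y) (cF _).
  rewrite -(opprB (F um)) e -(opprB um up) mulrN opprK addrC -mulrBl.
  rewrite mulr_ge0 ?subr_ge0//.
  apply: ub_le_sup; last by exists c.
  have [m _ hm] := EVT_max le (cw _).
  by exists (f m) => _ [w wI <-]; exact: hm.
Qed.

Lemma continuous_power_flux p : continuous (@power_flux R p).
Proof.
move=> y; apply: cvgM; last exact: cvg_cst.
exact: exprn_continuous.
Qed.

Lemma power_flux_primitive p (w : R) : (0 < p)%N ->
  is_derive w 1 (fun y => power_flux p.+1 y / p%:R) (power_flux p w).
Proof.
move=> p0.
have -> : (fun y => power_flux p.+1 y / p%:R)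
    = horner ((p.+1%:R * p%:R : R)^-1 *: 'X^(p.+1)).
  by apply/funext => z; rewrite /power_flux hornerZ hornerXn invfM; ring.
apply: (is_derive_eq (is_derive_poly _ w)).
rewrite derivZ derivXn hornerZ /power_flux.
by rewrite hornerMn hornerXn; field; rewrite nat1r !pnatr_eq0 -lt0n p0.
Qed.

End Fluxes.

(** * Conservation of mass, dissipation or conservation of energy *)

Lemma is_derive_derive1 {R : realType} (f : R -> R) (t df : R) :
  is_derive t 1 f df -> derivable f t 1 /\ derive1 f t = df.
Proof. by case=> dfx <-; rewrite derive1E. Qed.

Theorem proposition2p2 (R : realType) (p : nat) (hp : (2 <= p)%N)
    (a b : R) (N : nat) (x : nat -> R) (hx : is_mesh a b N x) (k : nat)
    (J : set R) (hJ : open J) (u v q : R -> 'I_N -> {poly R}) :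
  (D1_solution k x (@power_flux R p) J u v q ->
   forall t : R, J t ->
     (derivable (fun s : R => E0 a b x (u s)) t 1 /\
      derive1 (fun s : R => E0 a b x (u s)) t = 0) /\
     (derivable (fun s : R => E2 a b x (u s)) t 1 /\
      derive1 (fun s : R => E2 a b x (u s)) t <= 0)) /\
  (forall F : R -> R,
   (forall w : R, is_derive w 1 F (power_flux p w)) ->
   C1_solution k x (@power_flux R p) F J u v q ->
   forall t : R, J t ->
     (derivable (fun s : R => E0 a b x (u s)) t 1 /\
      derive1 (fun s : R => E0 a b x (u s)) t = 0) /\
     (derivable (fun s : R => E2 a b x (u s)) t 1 /\
      derive1 (fun s : R => E2 a b x (u s)) t = 0)).
Proof.
have cf := @continuous_power_flux R p.
split=> [sol t Jt|F dF sol t Jt].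
- have [dE0 E0'] := is_derive_derive1 (mass_balance hx hJ Jt sol).
  pose F (w : R) := power_flux p.+1 w / p%:R.
  have dF (w : R) : is_derive w 1 F (power_flux p w).
    exact: power_flux_primitive (ltnW hp).
  have gadd : additive_flux (@flux_minus R) by [].
  have [dE2 E2'] := is_derive_derive1 (energy_balance hx cf dF gadd hJ Jt sol).
  split; split; [exact: dE0|exact: E0'|exact: dE2|].
  rewrite E2' mulrn_wle0// oppr_le0.
  rewrite -addrA addr_ge0 ?sumr_ge0// => [i _|].
    exact: production_godunov.
  rewrite -sumrN addr_ge0 ?sumr_ge0// => i _.
    by rewrite production_minus divr_ge0 ?sqr_ge0.
  by rewrite production_plus opprK divr_ge0 ?sqr_ge0.
- have [dE0 E0'] := is_derive_derive1 (mass_balance hx hJ Jt sol).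
  have gadd : additive_flux (@flux_avg R).
    by move=> um up wm wp; rewrite /flux_avg; field.
  have [dE2 E2'] := is_derive_derive1 (energy_balance hx cf dF gadd hJ Jt sol).
  split; split; [exact: dE0|exact: E0'|exact: dE2|].
  rewrite E2' /total_production !big1 => [|i _|i _|i _].
  + by rewrite addr0 subr0 oppr0 mul0rn.
  + exact: production_avg.
  + exact: production_avg.
  + exact: production_cons.
Qed.
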